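(* For any divisible ordered abelian group $G\neq\{0\}$, the field $\mathbb{R}((G))$ of generalized power series over $G$ with real coefficients is not an IPA-real closed field; that is, it has no integer part whose non-negative cone is a model of Peano Arithmetic.
   Context: $\mathbb{R}((G))$ is the field of formal sums $\sum_{g\in G}c_gt^g$ with $c_g\in\mathbb{R}$ and well-ordered support $\{g\in G:c_g\ne0\}$, with pointwise addition, convolution multiplication, and the lexicographic ordering (a non-zero series is positive iff the coefficient at the least element of its support is positive). For divisible $G\neq\{0\}$ it is a non-Archimedean real closed field. Integer part: an integer part of an ordered field $R$ is a discretely ordered subring $Z\subseteq R$ such that for every $r\in R$ there is $z\in Z$ with $z\le r<z+1$. Its non-negative cone is $Z^{\ge0}$, regarded as a structure in the language $\{+,\cdot,0,1,<\}$. Peano Arithmetic (PA) is the theory of non-negative cones of discretely ordered commutative rings with $1$ together with the induction axiom for every first-order formula of $\{+,\cdot,0,1,<\}$. An IPA-real closed field is a non-Archimedean real closed field which admits an integer part whose non-negative cone is a model of PA. *)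

(* Defs.v *)
From HB Require Import structures.
From mathcomp Require Import all_boot all_order all_algebra.
From mathcomp Require Import all_classical all_reals.

Set Implicit Arguments.
Unset Strict Implicit.
Unset Printing Implicit Defensive.

Import Order.TTheory GRing.Theory Num.Theory.
Local Open Scope classical_set_scope.
Local Open Scope ring_scope.

(* Totality is part of this mixin, instead of being inherited from [Order.Total],
   because the algebra and lattice hierarchies only join at [realDomainType]; the
   generic instance below gives access to the theory of total orders. *)
HB.mixin Record POrderedZmodule_isOrdered G of Num.POrderedZmodule G := {
  oag_total : total (<=%R : rel G);
  oag_leD2 : forall x y z : G, x <= y -> x + z <= y + z
}.

#[short(type="oagType")]
HB.structure Definition OrderedAbelianGroup :=
  { G of Num.POrderedZmodule G & POrderedZmodule_isOrdered G }.

HB.instance Definition _ (G : oagType) :=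
  Order.POrder_isTotal.Build ring_display (OrderedAbelianGroup.sort G) (@oag_total G).

Definition divisible_group (G : zmodType) :=
  forall (g : G) (n : nat), (0 < n)%N -> exists h : G, h *+ n = g.

Section OagTheory.
Context {G : oagType}.
Implicit Types x y z : G.

Lemma oag_leD2r z x y : (x + z <= y + z) = (x <= y).
Proof.
apply/idP/idP; last exact: oag_leD2.
by move=> /(@oag_leD2 G _ _ (- z)); rewrite !addrK.
Qed.

Lemma oag_leD2l z x y : (z + x <= z + y) = (x <= y).
Proof. by rewrite ![z + _]addrC oag_leD2r. Qed.

Lemma oag_ltD2r z x y : (x + z < y + z) = (x < y).
Proof. by rewrite !ltNge oag_leD2r. Qed.

Lemma oag_ltD2l z x y : (z + x < z + y) = (x < y).
Proof. by rewrite !ltNge oag_leD2l. Qed.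

Lemma oag_ltD x y z t : x < y -> z <= t -> x + z < y + t.
Proof.
by move=> xy zt; apply: (@lt_le_trans _ _ (y + z)); rewrite ?oag_ltD2r ?oag_leD2l.
Qed.

Lemma oag_ltBlDl x y z : (x - y < z) = (x < y + z).
Proof. by rewrite -[LHS](oag_ltD2r y) subrK addrC. Qed.

Lemma oag_ltBrDl x y z : (x < y - z) = (z + x < y).
Proof. by rewrite -[LHS](oag_ltD2r z) subrK addrC. Qed.

End OagTheory.

Definition well_ordered_set (G : oagType) (A : set G) : Prop :=
  forall B : set G, B `<=` A -> B !=set0 ->
  exists2 m, B m & forall b, B b -> m <= b.

Section WellOrderedSets.
Context {G : oagType}.
Implicit Types (A B : set G).

Lemma wo_sub A B : A `<=` B -> well_ordered_set B -> well_ordered_set A.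
Proof. by move=> AB woB C CA; apply: woB; apply: subset_trans AB. Qed.

Lemma wo_set1 (g : G) : well_ordered_set [set g].
Proof.
move=> B Bg [x Bx]; exists x => // b /Bg /= ->.
by have /= -> := Bg _ Bx.
Qed.

Lemma wo_set0 : well_ordered_set (set0 : set G).
Proof. by move=> B B0 [x /B0]. Qed.

Lemma wo_setU A B :
  well_ordered_set A -> well_ordered_set B -> well_ordered_set (A `|` B).
Proof.
move=> woA woB C CAB [x Cx].
have [CA0|/nonemptyPn CA0] := pselect ((C `&` A) !=set0); last first.
  apply: woB; last by exists x.
  move=> c Cc; case: (CAB _ Cc) => // Ac.
  by have : (C `&` A) c by []; rewrite CA0.
have [CB0|/nonemptyPn CB0] := pselect ((C `&` B) !=set0); last first.
  apply: woA; last by exists x.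
  move=> c Cc; case: (CAB _ Cc) => // Bc.
  by have : (C `&` B) c by []; rewrite CB0.
have [a [Ca Aa] mina] := woA _ (@subIsetr _ C A) CA0.
have [b [Cb Bb] minb] := woB _ (@subIsetr _ C B) CB0.
exists (Order.min a b); first by rewrite minEle; case: ifP.
move=> c Cc; rewrite ge_min; case: (CAB _ Cc) => Hc.
  by rewrite mina.
by rewrite minb ?orbT.
Qed.

Lemma wo_ind A (P : G -> Prop) : well_ordered_set A ->
  (forall a, A a -> (forall b, A b -> b < a -> P b) -> P a) ->
  forall a, A a -> P a.
Proof.
move=> woA IH a Aa; apply: contrapT => nPa.
have [|m [Am nPm] minm] := woA [set x | A x /\ ~ P x] (fun _ => @proj1 _ _).
  by exists a.
apply: nPm; apply: IH => // b Ab ltb; apply: contrapT => nPb.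
by have := minm b (conj Ab nPb); rewrite leNgt ltb.
Qed.

Definition set_add A B : set G := [set g | exists a b, [/\ A a, B b & g = a + b]].

Lemma wo_add A B :
  well_ordered_set A -> well_ordered_set B -> well_ordered_set (set_add A B).
Proof.
move=> woA woB.
have step (S : set G) : S `<=` set_add A B -> S !=set0 ->
    exists a b, [/\ A a, B b, S (a + b) &
      forall a' b', A a' -> B b' -> S (a' + b') -> a' + b' < a + b -> a' < a].
  move=> SAB [s Ss]; have [a [b [Aa Bb sE]]] := SAB _ Ss.
  have [||b0 [Bb0 [a0 Aa0 Sab0]] minb0] :=
    woB [set b | B b /\ exists2 a, A a & S (a + b)].
  - by move=> ? [].
  - by exists b; split=> //; exists a; rewrite // -sE.
  have [||a1 [Aa1 Sa1] mina1] := woA [set a | A a /\ S (a + b0)].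
  - by move=> ? [].
  - by exists a0; split.
  exists a1, b0; split=> // a' b' Aa' Bb' S' lt'; rewrite ltNge; apply/negP => le'.
  have leb : b0 <= b' by apply: minb0; split=> //; exists a'.
  by move: lt'; rewrite ltNge (le_trans (_ : _ <= a1 + b')) ?oag_leD2l ?oag_leD2r.
have main : forall a, A a -> forall S : set G, S `<=` set_add A B -> S !=set0 ->
   (forall a' b', A a' -> B b' -> S (a' + b') -> a' < a) ->
   exists2 m, S m & forall s, S s -> m <= s.
  apply: (wo_ind woA) => a Aa IH S SAB S0 lta.
  have [a0 [b0 [Aa0 Bb0 S00 lt0]]] := step _ SAB S0.
  have [S'0|S'0] := pselect ([set s | S s /\ s < a0 + b0] !=set0); last first.
    exists (a0 + b0) => // s Ss; rewrite leNgt; apply/negP => lts.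
    by apply: S'0; exists s.
  have lta0 : a0 < a by apply: (lta _ b0).
  have [||m [Sm ltm] minm] := IH a0 Aa0 lta0 [set s | S s /\ s < a0 + b0] _ S'0.
  - by move=> ? [/SAB].
  - by move=> a' b' Aa' Bb' [S' lt']; apply: (lt0 _ b').
  exists m => // s Ss; have [lts|les] := ltP s (a0 + b0); first exact: minm.
  by rewrite (le_trans (ltW ltm)).
move=> S SAB S0.
have [a0 [b0 [Aa0 Bb0 S00 lt0]]] := step _ SAB S0.
have [S'0|S'0] := pselect ([set s | S s /\ s < a0 + b0] !=set0); last first.
  exists (a0 + b0) => // s Ss; rewrite leNgt; apply/negP => lts.
  by apply: S'0; exists s.
have [||m [Sm ltm] minm] := main a0 Aa0 [set s | S s /\ s < a0 + b0] _ S'0.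
- by move=> ? [/SAB].
- by move=> a' b' Aa' Bb' [S' lt']; apply: (lt0 _ b').
exists m => // s Ss; have [lts|les] := ltP s (a0 + b0); first exact: minm.
by rewrite (le_trans (ltW ltm)).
Qed.

Lemma wo_conv_finite A B (g : G) :
  well_ordered_set A -> well_ordered_set B ->
  finite_set [set a | A a /\ B (g - a)].
Proof.
move=> woA woB; set F := [set a | _].
have woF : well_ordered_set F by apply: wo_sub woA => ? [].
have maxF (C : set G) : C `<=` F -> C !=set0 ->
    exists2 m, C m & forall c, C c -> c <= m.
  move=> CF [c Cc].
  have [||m [Bm Cm] minm] := woB [set b | B b /\ C (g - b)].
  - by move=> ? [].
  - by exists (g - c); rewrite /= subKr; split=> //; case: (CF _ Cc).
  exists (g - m) => // x Cx.
  have : m <= g - x by apply: minm => /=; rewrite subKr; split=> //; case: (CF _ Cx).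
  by rewrite -[m <= _](oag_leD2r (x - m)) [m + _]addrC subrK addrA subrK.
have [F0|/nonemptyPn ->] := pselect (F !=set0); last exact: finite_set0.
have fin : forall a, F a -> finite_set [set x | F x /\ x <= a].
  apply: (wo_ind woF) => a Fa IH.
  have [L0|L0] := pselect ([set x | F x /\ x < a] !=set0); last first.
    apply: (sub_finite_set _ (finite_set1 a)) => x [Fx]; rewrite le_eqVlt.
    by case/orP=> [/eqP//|ltx]; case: L0; exists x.
  have [|p [Fp ltp] maxp] := maxF [set x | F x /\ x < a] _ L0.
    by move=> ? [].
  have finU : finite_set ([set x | F x /\ x <= p] `|` [set a]).
    by rewrite finite_setU; split; [exact: IH|exact: finite_set1].
  apply: (sub_finite_set _ finU) => x [Fx]; rewrite le_eqVlt.
  by case/orP=> [/eqP ->|ltx]; [right|left; split=> //; apply: maxp].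
have [m Fm maxm] := maxF F (@subset_refl _ F) F0.
by apply: (sub_finite_set _ (fin m Fm)) => x Fx; split=> //; apply: maxm.
Qed.

End WellOrderedSets.
Arguments wo_set1 {G} g.

Record hahnSeries (R : realFieldType) (G : oagType) := HahnSeries {
  hcoef :> G -> R;
  _ : well_ordered_set [set g | hcoef g != 0]
}.

HB.instance Definition _ (R : realFieldType) (G : oagType) :=
  gen_eqMixin (hahnSeries R G).
HB.instance Definition _ (R : realFieldType) (G : oagType) :=
  gen_choiceMixin (hahnSeries R G).

Section HahnSeries.
Context {R : realFieldType} {G : oagType}.
Local Notation K := (hahnSeries R G).
Implicit Types (f h k : K) (g : G).

Definition hsupp f : set G := [set g | f g != 0].

Lemma hsupp_wo f : well_ordered_set (hsupp f).
Proof. by case: f. Qed.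
Arguments hsupp_wo : clear implicits.

Lemma hahnP f h : f =1 h -> f = h.
Proof.
case: f h => [f wof] [h woh] /= fh.
have E : f = h by apply: funext.
by subst h; congr HahnSeries; exact: Prop_irrelevance.
Qed.

Lemma wo_supp_sub (u : G -> R) (A : set G) : well_ordered_set A ->
  (forall g, u g != 0 -> A g) -> well_ordered_set [set g | u g != 0].
Proof. by move=> woA uA; apply: wo_sub woA. Qed.

Fact hzero_subproof : well_ordered_set [set g : G | (0 : R) != 0].
Proof. by apply: (wo_supp_sub wo_set0) => g; rewrite eqxx. Qed.
Definition hzero : K := HahnSeries (@hzero_subproof).

Fact hopp_subproof f : well_ordered_set [set g | - f g != 0].
Proof. by apply: (wo_supp_sub (hsupp_wo f)) => g; rewrite oppr_eq0. Qed.
Definition hopp f : K := HahnSeries (@hopp_subproof f).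

Fact hadd_subproof f h : well_ordered_set [set g | f g + h g != 0].
Proof.
apply: (wo_supp_sub (wo_setU (hsupp_wo f) (hsupp_wo h))) => g.
rewrite /setU /hsupp /=; have [->|] := eqVneq (f g) 0; last by left.
by rewrite add0r; right.
Qed.
Definition hadd f h : K := HahnSeries (@hadd_subproof f h).

Fact haddA : associative hadd.
Proof. by move=> f h k; apply: hahnP => g /=; rewrite addrA. Qed.
Fact haddC : commutative hadd.
Proof. by move=> f h; apply: hahnP => g /=; rewrite addrC. Qed.
Fact hadd0 : left_id hzero hadd.
Proof. by move=> f; apply: hahnP => g /=; rewrite add0r. Qed.
Fact haddN : left_inverse hzero hopp hadd.
Proof. by move=> f; apply: hahnP => g /=; rewrite addNr. Qed.

HB.instance Definition _ :=
  GRing.isZmodule.Build (hahnSeries R G) haddA haddC hadd0 haddN.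

Lemma hcoef0 g : (0 : K) g = 0. Proof. by []. Qed.
Lemma hcoefD f h g : (f + h) g = f g + h g. Proof. by []. Qed.
Lemma hcoefN f g : (- f) g = - f g. Proof. by []. Qed.
Lemma hcoefB f h g : (f - h) g = f g - h g. Proof. by []. Qed.

(* The family [a |-> f a * h (g - a)] has finite support ([conv_finite]), so
   that this finitely supported sum is never the junk value 0. *)
Definition hconv f h g : R := \sum_(a \in [set: G]) f a * h (g - a).

Definition conv_supp f h g : set G := [set a | hsupp f a /\ hsupp h (g - a)].

Lemma conv_finite f h g : finite_set (conv_supp f h g).
Proof. exact: wo_conv_finite (hsupp_wo f) (hsupp_wo h). Qed.

Lemma conv_suppP f h g a : f a * h (g - a) != 0 -> conv_supp f h g a.
Proof. by rewrite mulf_eq0 negb_or => /andP[]. Qed.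

Lemma hconvE f h g (P : set G) : conv_supp f h g `<=` P ->
  hconv f h g = \sum_(a \in P) f a * h (g - a).
Proof.
move=> sP; rewrite /hconv; apply/esym/fsbig_widen => // a [_ nPa] /=.
by apply/eqP; apply: contra_notT nPa => /conv_suppP/sP.
Qed.

Lemma hconv_neq0 f h g : hconv f h g != 0 -> set_add (hsupp f) (hsupp h) g.
Proof.
move=> H; apply: contrapT => nA; move/eqP: H; apply.
rewrite /hconv fsbig1 // => a _; apply/eqP; apply: contra_notT nA.
by move=> /conv_suppP [fa ha]; exists a, (g - a); split=> //; rewrite addrC subrK.
Qed.

Fact hmul_subproof f h : well_ordered_set [set g | hconv f h g != 0].
Proof. exact: (wo_supp_sub (wo_add (hsupp_wo f) (hsupp_wo h)) (@hconv_neq0 f h)). Qed.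
Definition hmul f h : K := HahnSeries (@hmul_subproof f h).

(* [hmono c g] is the monomial $c t^g$. *)
Fact hmono_subproof (c : R) g :
  well_ordered_set [set x | (if x == g then c else 0) != 0].
Proof.
by apply: (wo_supp_sub (wo_set1 g)) => x; case: (eqVneq x g) => // _ /eqP.
Qed.
Definition hmono (c : R) g : K := HahnSeries (@hmono_subproof c g).

Lemma hconv_bij g : bijective (fun a : G => g - a).
Proof. by exists (fun a => g - a) => a; rewrite subKr. Qed.

Fact hmulC : commutative hmul.
Proof.
move=> f h; apply: hahnP => g /=; rewrite /hconv (reindex_fsbigT _ _ (hconv_bij g)).
by apply: eq_fsbigr => a _; rewrite subKr mulrC.
Qed.

Lemma hmul_mono (c : R) x f g : hmul (hmono c x) f g = c * f (g - x).
Proof.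
rewrite /= (@hconvE _ _ _ [set x]); last first.
  by move=> a [] /=; rewrite /hsupp /=; case: (eqVneq a x) => // _ /eqP.
by rewrite fsbig_set1 /= eqxx.
Qed.

Fact hmul1 : left_id (hmono 1 0) hmul.
Proof. by move=> f; apply: hahnP => g; rewrite hmul_mono mul1r subr0. Qed.

Fact hmulDl : left_distributive hmul hadd.
Proof.
move=> f f' h; apply: hahnP => g /=.
pose P := conv_supp f h g `|` conv_supp f' h g.
have finP : finite_set P by rewrite finite_setU; split; exact: conv_finite.
rewrite !(@hconvE _ _ _ P); last 3 first.
- by move=> a; right.
- by move=> a; left.
- move=> a [] /=; rewrite /hsupp /P /conv_supp /setU /hsupp /=.
  by have [->|? ? ?] := eqVneq (f a) 0; [rewrite add0r; right|left].
rewrite -fsbig_split //; apply: eq_fsbigr => a _ /=.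
by rewrite mulrDl.
Qed.

Fact hmulA : associative hmul.
Proof.
move=> f h k; apply/esym/hahnP => g.
pose fh := set_add (hsupp f) (hsupp h); pose hk := set_add (hsupp h) (hsupp k).
pose P := [set a | hsupp f a /\ hk (g - a)].
pose Q := [set u | fh u /\ hsupp k (g - u)].
have finP : finite_set P.
  exact: wo_conv_finite (hsupp_wo f) (wo_add (hsupp_wo h) (hsupp_wo k)).
have finQ : finite_set Q.
  exact: wo_conv_finite (wo_add (hsupp_wo f) (hsupp_wo h)) (hsupp_wo k).
have Fsupp a u : f a * h (u - a) * k (g - u) != 0 -> P a /\ Q u.
  rewrite !mulf_eq0 !negb_or => /andP[/andP[fa hua] kgu]; split; split=> //.
    by exists (u - a), (g - u); split=> //; rewrite [RHS]addrC addrA subrK.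
  by exists a, (u - a); split=> //; rewrite addrC subrK.
transitivity (\sum_(u \in Q) \sum_(a \in P) f a * h (u - a) * k (g - u)).
  rewrite [LHS](@hconvE _ _ _ Q); last first.
    by move=> u [] /= /hconv_neq0.
  apply: eq_fsbigr => u _; rewrite -mulr_fsuml.
  have [->|kn0] := eqVneq (k (g - u)) 0; first by rewrite !mulr0.
  congr (_ * _); apply/esym/fsbig_widen => // a [_ nPa] /=.
  apply/eqP; apply: contra_notT nPa => fa.
  by have [] : P a /\ Q u by apply: Fsupp; rewrite mulf_neq0.
rewrite (exchange_fsbig _ _ finQ finP).
rewrite [RHS](@hconvE _ _ _ P); last first.
  by move=> a [] fa /= /hconv_neq0.
apply: eq_fsbigr => a _; have [->|fn0] := eqVneq (f a) 0.
  by rewrite mul0r fsbig1 // => u _; rewrite !mul0r.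
under eq_fsbigr do rewrite -mulrA.
rewrite -mulr_fsumr; congr (_ * _) => /=.
rewrite /hconv.
have bij : bijective (fun u : G => u - a).
  by exists (fun u => u + a) => u; rewrite ?addrK ?subrK.
rewrite (reindex_fsbigT _ _ bij).
transitivity (\sum_(u \in [set: G]) h (u - a) * k (g - u)).
  apply: fsbig_widen => // u [_ nQu] /=.
  apply/eqP; apply: contra_notT nQu => hku.
  by have [] : P a /\ Q u by apply: Fsupp; rewrite -mulrA mulf_neq0.
by apply: eq_fsbigr => u _; rewrite opprB addrA subrK.
Qed.

Fact hone_neq0 : hmono 1 0 != 0.
Proof.
apply/eqP => /(congr1 (fun f : K => f 0)) /=; rewrite eqxx => /eqP.
by rewrite oner_eq0.
Qed.

HB.instance Definition _ := GRing.Zmodule_isComNzRing.Build (hahnSeries R G)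
  hmulA hmulC hmul1 hmulDl hone_neq0.

Lemma hcoef1 g : (1 : K) g = (g == 0)%:R.
Proof. by rewrite /= /GRing.one /=; case: eqP. Qed.

Lemma hcoefM f h g : (f * h) g = \sum_(a \in [set: G]) f a * h (g - a).
Proof. by []. Qed.

Lemma hcoef_mono (c : R) x g : hmono c x g = if g == x then c else 0.
Proof. by []. Qed.

Lemma hcoefM_mono (c : R) x f g : (hmono c x * f) g = c * f (g - x).
Proof. exact: hmul_mono. Qed.

Definition vanish_below f g := forall x, x < g -> f x = 0.

Lemma hsupp_min f : f != 0 -> exists2 m, f m != 0 & vanish_below f m.
Proof.
move=> f0; have [|m fm minm] := hsupp_wo f _ (@subset_refl _ (hsupp f)).
  apply: contrapT => H; move/eqP: f0; apply; apply: hahnP => g.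
  by apply/eqP; apply: contra_notT H => fg; exists g.
exists m => // x ltx; apply/eqP; apply: contraTT ltx => fx.
by rewrite -leNgt; apply: minm.
Qed.

Lemma hmul_lead f h x y : vanish_below f x -> vanish_below h y ->
  vanish_below (f * h) (x + y) /\ (f * h) (x + y) = f x * h y.
Proof.
move=> vf vh; split=> [g ltg|].
  rewrite hcoefM fsbig1 // => a _.
  have [lta|lea] := ltP a x; first by rewrite vf // mul0r.
  rewrite vh ?mulr0 // oag_ltBlDl; apply: lt_le_trans ltg _.
  by rewrite oag_leD2r.
rewrite [LHS](@hconvE _ _ _ [set x]); last first.
  move=> a [fa ha] /=; apply/eqP; rewrite eq_le.
  apply/andP; split; rewrite leNgt; apply/negP => lt.
    move/eqP: ha; apply; apply: vh; rewrite oag_ltBlDl.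
    by rewrite oag_ltD2r.
  by move/eqP: fa; apply; apply: vf.
by rewrite fsbig_set1 addrAC subrr add0r.
Qed.

Section UnitInverse.
Variable f : K.
Hypothesis (vf : vanish_below f 0) (f0 : f 0 = 1).

(* Approximate inverse of [f] up to and including the exponent [g]. *)
Let approx h g :=
  (forall x, g < x -> h x = 0) /\ (forall x, x <= g -> (1 - f * h) x = 0).

Let vanish_mul h g : vanish_below h g -> vanish_below (f * h) g.
Proof. by move=> vh; have [] := hmul_lead vf vh; rewrite add0r. Qed.

Let vanish_mulV h g : (forall x, x <= g -> (f * h) x = 0) ->
  forall x, x <= g -> h x = 0.
Proof.
move=> vfh x lex; have [->//|h0] := eqVneq h 0.
have [m hm vm] := hsupp_min h0.
have [_] := hmul_lead vf vm; rewrite add0r f0 mul1r => E.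
have [ltm|lem] := ltP g m; first by apply: vm; apply: le_lt_trans ltm.
by move: hm; rewrite -E vfh ?eqxx.
Qed.

Let approx_uniq h h' g g' x : approx h g -> approx h' g' ->
  x <= g -> x <= g' -> h x = h' x.
Proof.
move=> [_ a] [_ a'] lx lx'; apply/eqP; rewrite -subr_eq0; apply/eqP.
rewrite -hcoefB; apply: (@vanish_mulV _ x) => // y ley.
have E : f * (h - h') = (1 - f * h') - (1 - f * h).
  by rewrite mulrBr opprB [RHS]addrC addrA subrK.
by rewrite E hcoefB a ?a' ?subrr // (le_trans ley).
Qed.

Let cover x := exists h g, approx h g /\ x <= g.

Let ycoef (x : G) : R :=
  if pselect (cover x) is left H then projT1 (cid H) x else 0.

Let ycoefE h g x : approx h g -> x <= g -> ycoef x = h x.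
Proof.
move=> a lx; rewrite /ycoef; case: pselect => [H|[]]; last by exists h, g.
by case: (cid H) => h' [g' [a' lx']] /=; apply: (approx_uniq a' a).
Qed.

Let ycoef_cover x : ycoef x != 0 -> cover x.
Proof. by rewrite /ycoef; case: pselect => //; rewrite eqxx. Qed.

Let ycoef_wo : well_ordered_set [set x | ycoef x != 0].
Proof.
move=> B By [b Bb]; have [h [g [a lb]]] := ycoef_cover (By _ Bb).
have [||m [Bm lm] minm] := hsupp_wo h _ (_ : [set x | B x /\ x <= g] `<=` _).
- by move=> x [Bx lx]; rewrite /hsupp /= -(ycoefE a lx); apply: By.
- by exists b.
exists m => // c Bc; have [lc|/ltW gc] := leP c g; first exact: minm.
exact: le_trans gc.
Qed.

Lemma hunit_inv : exists h, f * h = 1.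
Proof.
pose y : K := HahnSeries (@ycoef_wo).
have ry x : cover x -> (1 - f * y) x = 0.
  move=> [h [g [a lx]]].
  have -> : 1 - f * y = (1 - f * h) - f * (y - h).
    by rewrite mulrBr opprB addrA subrK.
  rewrite hcoefB a.2 // sub0r.
  have vyh : vanish_below (y - h) x.
    move=> z ltz; rewrite hcoefB /= (ycoefE a) ?subrr //.
    exact: ltW (lt_le_trans ltz lx).
  have [_] := hmul_lead vf vyh; rewrite add0r f0 mul1r hcoefB => ->.
  by rewrite /= (ycoefE a lx) subrr oppr0.
exists y; apply/esym/eqP; rewrite -subr_eq0; apply: contrapT => /negP r0.
have [m rm vm] := hsupp_min r0.
pose c := (1 - f * y) m.
have ncover x : m <= x -> ~ cover x.
  move=> lx [h [g [a lxg]]]; move/eqP: rm; apply; apply: ry.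
  by exists h, g; split=> //; apply: le_trans lxg.
have y0 x : m <= x -> y x = 0.
  by move=> lx; apply/eqP; apply: contra_notT (ncover x lx) => /ycoef_cover.
have am : approx (y + hmono c m) m.
  split=> x lx; first by rewrite hcoefD y0 ?(ltW lx) // hcoef_mono gt_eqF ?addr0.
  have -> : 1 - f * (y + hmono c m) = (1 - f * y) - hmono c m * f.
    by rewrite mulrDr opprD addrA [f * hmono _ _]mulrC.
  rewrite hcoefB hcoefM_mono; move: lx; rewrite le_eqVlt => /orP[/eqP ->|ltx].
    by rewrite subrr f0 mulr1 subrr.
  by rewrite vm // vf ?mulr0 ?subrr // oag_ltBlDl addr0.
by apply: (ncover m) => //; exists (y + hmono c m), m.
Qed.

End UnitInverse.

Lemma hahn_inv f : f != 0 -> exists h, h * f = 1.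
Proof.
move=> f0; have [m fm vm] := hsupp_min f0.
pose u := hmono (f m)^-1 (- m).
have [||h Eh] := @hunit_inv (u * f).
- move=> x ltx; rewrite hcoefM_mono opprK (vm (x + m)) ?mulr0 //.
  by rewrite -[X in _ < X]add0r oag_ltD2r.
- by rewrite hcoefM_mono opprK add0r mulVf.
by exists (h * u); rewrite -mulrA mulrC.
Qed.

Definition hinv f : K :=
  if pselect (f != 0) is left H then projT1 (cid (hahn_inv H)) else 0.

Fact hmulVf f : f != 0 -> hinv f * f = 1.
Proof. by move=> f0; rewrite /hinv; case: pselect => // H; case: cid. Qed.

Fact hinv0 : hinv 0 = 0.
Proof. by rewrite /hinv; case: pselect => // H; exfalso; move: H; rewrite eqxx. Qed.

HB.instance Definition _ :=
  GRing.ComNzRing_isField.Build (hahnSeries R G) hmulVf hinv0.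

Definition hpos f : Prop := exists2 m, 0 < f m & vanish_below f m.

Definition hlt f h : bool := `[< hpos (h - f) >].
Definition hle f h : bool := (f == h) || hlt f h.
Definition hnorm f : K := if hle 0 f then f else - f.

Fact hlt0P f : reflect (hpos f) (hlt 0 f).
Proof. by rewrite /hlt subr0; apply: asboolP. Qed.

Fact hgt0P f : reflect (hpos (- f)) (hlt f 0).
Proof. by rewrite /hlt sub0r; apply: asboolP. Qed.

Fact hposN f : hpos f -> ~ hpos (- f).
Proof.
move=> [m fm vm] [n fn vn]; rewrite hcoefN in fn.
have [ltmn|ltnm|E] := ltgtP m n.
- by have := vn _ ltmn; rewrite hcoefN => /eqP; rewrite oppr_eq0 gt_eqF.
- by move: fn; rewrite vm // oppr0 ltxx.
- by move: fn; rewrite -E oppr_gt0 => /(lt_trans fm); rewrite ltxx.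
Qed.

Fact hlt0_add f h : hlt 0 f -> hlt 0 h -> hlt 0 (f + h).
Proof.
move=> /hlt0P[m fm vm] /hlt0P[n hn vn]; apply/hlt0P.
have [ltmn|ltnm|E] := ltgtP m n.
- exists m; first by rewrite hcoefD (vn m) // addr0.
  by move=> x ltx; rewrite hcoefD vm // vn ?addr0 // (lt_trans ltx).
- exists n; first by rewrite hcoefD (vm n) // add0r.
  by move=> x ltx; rewrite hcoefD vn // vm ?addr0 // (lt_trans ltx).
- exists m; first by rewrite hcoefD addr_gt0 // E.
  by move=> x ltx; rewrite hcoefD vm // vn ?addr0 // -E.
Qed.

Fact hlt0_mul f h : hlt 0 f -> hlt 0 h -> hlt 0 (f * h).
Proof.
move=> /hlt0P[m fm vm] /hlt0P[n hn vn]; apply/hlt0P.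
have [v E] := hmul_lead vm vn; exists (m + n) => //.
by rewrite E mulr_gt0.
Qed.

Fact hlt0_ngt0 f : hlt 0 f -> ~~ hlt f 0.
Proof. by move=> /hlt0P fp; apply/negP => /hgt0P; apply: hposN. Qed.

Fact hsub_gt0 f h : hlt 0 (h - f) = hlt f h.
Proof. by rewrite /hlt subr0. Qed.

Fact hlt0_total f : f != 0 -> hlt 0 f || hlt f 0.
Proof.
move=> /hsupp_min[m fm vm]; move: (fm); rewrite neq_lt => /orP[lt|gt].
  apply/orP; right; apply/hgt0P; exists m; first by rewrite hcoefN oppr_gt0.
  by move=> x ltx; rewrite hcoefN vm // oppr0.
by apply/orP; left; apply/hlt0P; exists m.
Qed.

Fact hnormN f : hnorm (- f) = hnorm f.
Proof.
have [->|f0] := eqVneq f 0; first by rewrite oppr0.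
rewrite /hnorm /hle ![0 == _]eq_sym oppr_eq0 (negbTE f0) /=.
case/orP: (hlt0_total f0) => lt.
  rewrite lt opprK; case: ifP => // /hlt0P /hgt0P lt'.
  by have := hlt0_ngt0 lt; rewrite lt'.
have -> : hlt 0 (- f) by apply/hlt0P/hgt0P.
by case: ifP => // /hlt0_ngt0; rewrite lt.
Qed.

Fact hge0_norm f : hle 0 f -> hnorm f = f.
Proof. by rewrite /hnorm => ->. Qed.

HB.instance Definition _ := Num.IntegralDomain_isLtReal.Build (hahnSeries R G)
  hlt0_add hlt0_mul hlt0_ngt0 hsub_gt0 hlt0_total hnormN hge0_norm
  (fun _ _ => erefl).

Lemma hahn_gt0P f :
  reflect (exists2 m, 0 < f m & forall x, x < m -> f x = 0) (0 < f).
Proof. exact: hlt0P. Qed.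

End HahnSeries.
Arguments hsupp_wo {R G} f.


Inductive arith_term :=
| ArVar of nat
| ArZero
| ArOne
| ArAdd of arith_term & arith_term
| ArMul of arith_term & arith_term.

(* Satisfaction being classical, the remaining connectives and the existential
   quantifier are definable. *)
Inductive arith_formula :=
| ArEq of arith_term & arith_term
| ArLt of arith_term & arith_term
| ArFalse
| ArImp of arith_formula & arith_formula
| ArForall of nat & arith_formula.

Record arith_structure := ArithStructure {
  ar_carrier :> Type;
  ar_zero : ar_carrier;
  ar_one : ar_carrier;
  ar_add : ar_carrier -> ar_carrier -> ar_carrier;
  ar_mul : ar_carrier -> ar_carrier -> ar_carrier;
  ar_lt : ar_carrier -> ar_carrier -> Prop
}.

Section Satisfaction.
Variable M : arith_structure.

Definition ar_update (e : nat -> M) (i : nat) (x : M) : nat -> M :=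
  fun j => if j == i then x else e j.

Fixpoint ar_eval (e : nat -> M) (t : arith_term) : M :=
  match t with
  | ArVar i => e i
  | ArZero => ar_zero M
  | ArOne => ar_one M
  | ArAdd t1 t2 => ar_add (ar_eval e t1) (ar_eval e t2)
  | ArMul t1 t2 => ar_mul (ar_eval e t1) (ar_eval e t2)
  end.

Fixpoint ar_sat (e : nat -> M) (phi : arith_formula) : Prop :=
  match phi with
  | ArEq t1 t2 => ar_eval e t1 = ar_eval e t2
  | ArLt t1 t2 => ar_lt (ar_eval e t1) (ar_eval e t2)
  | ArFalse => False
  | ArImp phi1 phi2 => ar_sat e phi1 -> ar_sat e phi2
  | ArForall i phi1 => forall x : M, ar_sat (ar_update e i x) phi1
  end.

(* Truth of the universal closure. *)
Definition ar_valid (phi : arith_formula) : Prop := forall e, ar_sat e phi.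

(* The induction axiom for [phi] with respect to the variable [i]; the other
   free variables of [phi] are parameters, interpreted by [e]. *)
Definition ar_induction (i : nat) (phi : arith_formula) : Prop :=
  forall e : nat -> M,
    ar_sat (ar_update e i (ar_zero M)) phi ->
    (forall x : M, ar_sat (ar_update e i x) phi ->
                   ar_sat (ar_update e i (ar_add x (ar_one M))) phi) ->
    forall x : M, ar_sat (ar_update e i x) phi.

End Satisfaction.

Definition discretely_ordered (A : realDomainType) (Z : subringClosed A) : Prop :=
  forall z : A, z \in Z -> 0 < z -> 1 <= z.

Section NonNegCone.
Variables (A : realDomainType) (Z : subringClosed A).

Definition nneg_cone_sort : Type := {x : A | (x \in Z) && (0 <= x)}.

Fact nneg_cone0_subproof : (0 \in Z) && (0 <= 0 :> A).
Proof. by rewrite rpred0 lexx. Qed.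

Fact nneg_cone1_subproof : (1 \in Z) && (0 <= 1 :> A).
Proof. by rewrite rpred1 ler01. Qed.

Fact nneg_coneD_subproof (x y : nneg_cone_sort) :
  (val x + val y \in Z) && (0 <= val x + val y).
Proof.
by have [/andP[Zx x0] /andP[Zy y0]] := (valP x, valP y); rewrite rpredD ?addr_ge0.
Qed.

Fact nneg_coneM_subproof (x y : nneg_cone_sort) :
  (val x * val y \in Z) && (0 <= val x * val y).
Proof.
by have [/andP[Zx x0] /andP[Zy y0]] := (valP x, valP y); rewrite rpredM ?mulr_ge0.
Qed.

Definition nneg_cone : arith_structure := {|
  ar_carrier := nneg_cone_sort;
  ar_zero := exist _ 0 nneg_cone0_subproof;
  ar_one := exist _ 1 nneg_cone1_subproof;
  ar_add := fun x y => exist _ (val x + val y) (nneg_coneD_subproof x y);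
  ar_mul := fun x y => exist _ (val x * val y) (nneg_coneM_subproof x y);
  ar_lt := fun x y => val x < val y
|}.

End NonNegCone.

(* The theory of non-negative cones of discretely ordered commutative rings
   with 1. Such a ring is an integral domain, and is presented here as a subring
   of a [realDomainType] (possibly the whole of it). *)
Definition cone_theory (phi : arith_formula) : Prop :=
  forall (A : realDomainType) (Z : subringClosed A),
    discretely_ordered Z -> ar_valid (nneg_cone Z) phi.

Definition models_PA (M : arith_structure) : Prop :=
  (forall phi, cone_theory phi -> ar_valid M phi) /\
  (forall i phi, ar_induction M i phi).

Definition integer_part (K : realFieldType) (Z : subringClosed K) : Prop :=
  discretely_ordered Z /\
  (forall r : K, exists2 z, z \in Z & z <= r < z + 1).

Definition has_PA_integer_part (K : realFieldType) : Prop :=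
  exists Z : subringClosed K, integer_part Z /\ models_PA (nneg_cone Z).

Definition IPA_real_closed_field (K : realFieldType) : Prop :=
  [/\ ~ Num.archimedean_axiom K, Num.real_closed_axiom K
    & has_PA_integer_part K].

(* Main.v *)
Require Import Defs.
From mathcomp Require Import all_boot all_order all_algebra.
From mathcomp Require Import all_classical all_reals.
From mathcomp Require Import ring lra.

(* Write v for the natural valuation of K = R((G)) and let Z be an integer part
   of K whose cone satisfies PA. Instead of exponentiation we use the fast
   growing definable sequences E(n) = lcm of the 1 + (j+1)d for j < n, where d is
   a common multiple of 1, ..., B: the moduli are then pairwise coprime, so that
   d E(n) < E(n+1) for n < B. By overspill B can be taken infinite with E(B)
   below any given infinite element, so for every g < 0 in G the map
   phi(y) = v(E(floor y)) goes from an interval [1, B] of K to [g, 0), and it is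
   strictly decreasing on points at distance at least 1.

   Iterating, choose g_n, B_n and phi_n with v(B_n) < g_(n+1) < 0. As in the
   argument of Kuhlmann, Kuhlmann and Shelah against exponentials on power series
   fields, consider families of well-ordered sets S_n in [g_n, 0). The series
   B_n - sum_(s in S_(n+1)) t^s lies in [1, B_n], and decreases by an infinite
   amount when S_(n+1) grows, so phi_n sends it to an element s_n of [g_n, 0)
   which increases with S_(n+1). If every S_n lies strictly below s_n, adding
   s_n to S_n for all n simultaneously preserves this property, and so do
   unions of chains for end extension; this contradicts Zorn's lemma. *)

Set Implicit Arguments.
Unset Strict Implicit.
Unset Printing Implicit Defensive.

Import Order.TTheory GRing.Theory Num.Theory.
Local Open Scope classical_set_scope.
Local Open Scope ring_scope.

(** * Formulas and their meaning in the cone *)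

Definition arNot p := ArImp p ArFalse.
Definition arAnd p q := arNot (ArImp p (arNot q)).
Definition arEx i p := arNot (ArForall i (arNot p)).

Section ConeSatisfaction.
Context {K : realFieldType} {Z : subringClosed K}.
Local Notation M := (nneg_cone Z).
Implicit Types (e : nat -> M) (p q : arith_formula).

Definition in_cone (x : K) : bool := (x \in Z) && (0 <= x).

Definition to_cone (x : K) (Nx : in_cone x) : M := exist _ x Nx.

Lemma sat_imp e p q (P Q : Prop) :
  (ar_sat e p <-> P) -> (ar_sat e q <-> Q) -> ar_sat e (ArImp p q) <-> (P -> Q).
Proof. by move=> pP qQ /=; rewrite pP qQ. Qed.

Lemma sat_and e p q (P Q : Prop) :
  (ar_sat e p <-> P) -> (ar_sat e q <-> Q) -> ar_sat e (arAnd p q) <-> P /\ Q.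
Proof.
move=> pP qQ /=; rewrite pP qQ; split=> [nPQ|[HP HQ] PnQ]; last exact: PnQ.
by split; apply: contrapT => nH; apply: nPQ.
Qed.

Lemma sat_all e i p (P : K -> Prop) :
  (forall x (Nx : in_cone x), ar_sat (ar_update e i (to_cone Nx)) p <-> P x) ->
  ar_sat e (ArForall i p) <-> forall x, in_cone x -> P x.
Proof.
move=> pP /=; split=> [all_p x Nx|all_P [x Nx]].
  by apply/(pP _ Nx)/all_p.
by apply/(pP _ Nx)/all_P.
Qed.

Lemma sat_ex e i p (P : K -> Prop) :
  (forall x (Nx : in_cone x), ar_sat (ar_update e i (to_cone Nx)) p <-> P x) ->
  ar_sat e (arEx i p) <-> exists2 x, in_cone x & P x.
Proof.
move=> pP /=; split=> [nall|[x Nx Px] nall].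
  apply: contrapT => nex; apply: nall => -[x Nx] px.
  by apply: nex; exists x => //; apply/(pP _ Nx).
by apply: (nall (to_cone Nx)); apply/(pP _ Nx).
Qed.

Lemma sat_eq e t1 t2 :
  ar_sat e (ArEq t1 t2) <-> val (ar_eval e t1) = val (ar_eval e t2).
Proof. by split=> /= [->|/val_inj]. Qed.

Lemma sat_lt e t1 t2 :
  ar_sat e (ArLt t1 t2) <-> val (ar_eval e t1) < val (ar_eval e t2).
Proof. by []. Qed.

End ConeSatisfaction.
Arguments in_cone {K} Z x.

(** * Discreteness and definable induction *)

Section FastSequence.
Context {K : realFieldType} {Z : subringClosed K}.
Hypothesis Zip : integer_part Z.
Hypothesis Zind : forall i phi, ar_induction (nneg_cone Z) i phi.
Local Notation M := (nneg_cone Z).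
Local Notation N := (in_cone Z).

Lemma cone_in x : N x -> x \in Z. Proof. by case/andP. Qed.
Lemma cone_ge0 x : N x -> 0 <= x. Proof. by case/andP. Qed.
Lemma cone_inP x : x \in Z -> 0 <= x -> N x. Proof. by move=> *; apply/andP. Qed.

Lemma coneD x y : N x -> N y -> N (x + y).
Proof. by move=> /andP[? ?] /andP[? ?]; rewrite /in_cone rpredD ?addr_ge0. Qed.

Lemma coneM x y : N x -> N y -> N (x * y).
Proof. by move=> /andP[? ?] /andP[? ?]; rewrite /in_cone rpredM ?mulr_ge0. Qed.

Lemma cone0 : N 0. Proof. by rewrite /in_cone rpred0 lexx. Qed.
Lemma cone1 : N 1. Proof. by rewrite /in_cone rpred1 ler01. Qed.
Lemma cone_nat n : N n%:R. Proof. by rewrite /in_cone rpred_nat ler0n. Qed.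

Lemma int_ge1 x : x \in Z -> 0 < x -> 1 <= x.
Proof. by case: Zip => H _; apply: H. Qed.

Lemma int_lt_add1 x y : x \in Z -> y \in Z -> (x < y + 1) = (x <= y).
Proof.
move=> Zx Zy; apply/idP/idP => [lt|le]; last lra.
rewrite leNgt; apply/negP => gt.
by have := @int_ge1 (x - y) (rpredB Zx Zy); lra.
Qed.

(** All inductions over the cone go through this lemma: its first hypothesis certifies that [P] is
    definable by [phi] with parameters [e]. *)
Lemma cone_ind (i : nat) phi (e : nat -> M) (P : K -> Prop) :
  (forall x (Nx : N x), ar_sat (ar_update e i (to_cone Nx)) phi <-> P x) ->
  P 0 -> (forall x, N x -> P x -> P (x + 1)) -> forall x, N x -> P x.
Proof.
move=> phiP P0 PS x Nx; apply/(phiP _ Nx)/Zind.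
  by apply/(phiP _ (nneg_cone0_subproof Z)).
move=> [y Ny] /(phiP _ Ny) Py.
exact: (proj2 (phiP (y + 1) (nneg_coneD_subproof (to_cone Ny) (ar_one M)))
  (PS y Ny Py)).
Qed.

(** * Moduli of Goedel's beta function and their least common multiples *)

Definition modulus (d j : K) := 1 + (j + 1) * d.

Lemma cone_modulus d j : N d -> N j -> N (modulus d j).
Proof. by move=> Nd Nj; rewrite /modulus !(coneD, coneM, cone1). Qed.

Lemma modulus_gt0 d j : N d -> N j -> 0 < modulus d j.
Proof.
move=> /cone_ge0 d0 /cone_ge0 j0; rewrite ltr_pwDl ?ltr01 // mulr_ge0 //.
by rewrite addr_ge0 ?ler01.
Qed.

Definition common_multiple (d n w : K) :=
  forall j, N j -> j < n -> exists2 q, N q & w = modulus d j * q.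

Definition multiple_upto (n d : K) :=
  forall j, N j -> j < n -> exists2 q, N q & d = (j + 1) * q.

Let tS t := ArAdd t ArOne.
Let tmod d j := ArAdd ArOne (ArMul (tS (ArVar j)) (ArVar d)).

(* The variables 10 and 11 are bound, so that d, n and w must be below 10. *)
Let fcm d n w := ArForall 10 (ArImp (ArLt (ArVar 10) (ArVar n))
  (arEx 11 (ArEq (ArVar w) (ArMul (tmod d 10) (ArVar 11))))).

Let fmu n d := ArForall 10 (ArImp (ArLt (ArVar 10) (ArVar n))
  (arEx 11 (ArEq (ArVar d) (ArMul (tS (ArVar 10)) (ArVar 11))))).

Lemma sat_fcm (e : nat -> M) d n w : (d < 10)%N -> (n < 10)%N -> (w < 10)%N ->
  ar_sat e (fcm d n w) <->
  common_multiple (val (e d)) (val (e n)) (val (e w)).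
Proof.
move=> d10 n10 w10; apply: sat_all => j Nj; apply: sat_imp.
  by apply: (iff_trans (sat_lt _ _ _)); rewrite /= /ar_update /= (ltn_eqF n10).
apply: sat_ex => q Nq; apply: (iff_trans (sat_eq _ _ _)).
by rewrite /= /ar_update /= !ltn_eqF // (ltn_trans _ (ltnSn 10)).
Qed.

Lemma sat_fmu (e : nat -> M) n d : (d < 10)%N -> (n < 10)%N ->
  ar_sat e (fmu n d) <-> multiple_upto (val (e n)) (val (e d)).
Proof.
move=> d10 n10; apply: sat_all => j Nj; apply: sat_imp.
  by apply: (iff_trans (sat_lt _ _ _)); rewrite /= /ar_update /= (ltn_eqF n10).
apply: sat_ex => q Nq; apply: (iff_trans (sat_eq _ _ _)).
by rewrite /= /ar_update /= !ltn_eqF // (ltn_trans _ (ltnSn 10)).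
Qed.

(** The property to be overspilled, nested like the formula that expresses it; [w < m + 1] encodes
    $w \le m$, the language having only a strict order. *)
Definition fits (m n : K) := exists2 d, N d & exists2 w, N w &
  0 < d /\ (0 < w /\ (w < m + 1 /\ (multiple_upto n d /\ common_multiple d n w))).

Lemma fits_ind m : N m -> fits m 0 ->
  (forall n, N n -> fits m n -> fits m (n + 1)) -> forall n, N n -> fits m n.
Proof.
move=> Nm; apply: (@cone_ind 1 (arEx 2 (arEx 3
  (arAnd (ArLt ArZero (ArVar 2)) (arAnd (ArLt ArZero (ArVar 3))
  (arAnd (ArLt (ArVar 3) (tS (ArVar 0)))
  (arAnd (fmu 1 2) (fcm 2 1 3))))))) (fun=> to_cone Nm)) => n Nn.
apply: sat_ex => d Nd; apply: sat_ex => w Nw.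
do 3![apply: sat_and; first exact: sat_lt].
by apply: sat_and; [exact: sat_fmu|exact: sat_fcm].
Qed.

(** The least number principle: if there were no least one, induction on [x] would exclude every
    positive common multiple below [x]. *)
Lemma least_multiple d n w0 : N d -> N n -> N w0 -> 0 < w0 ->
  common_multiple d n w0 ->
  exists2 w, N w /\ (0 < w /\ common_multiple d n w) &
    forall w', N w' -> 0 < w' -> common_multiple d n w' -> w <= w'.
Proof.
move=> Nd Nn Nw0 w0_gt0 cm0; apply: contrapT => nleast.
have below : forall x, N x ->
    forall w, N w -> w < x -> 0 < w -> ~ common_multiple d n w.
  pose phi := ArForall 3 (ArImp (ArLt (ArVar 3) (ArVar 2))
    (ArImp (ArLt ArZero (ArVar 3)) (arNot (fcm 0 1 3)))).
  pose e i := if i is 0%N then to_cone Nd else to_cone Nn.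
  apply: (@cone_ind 2 phi e) => [x Nx|w /cone_ge0|x Nx IH w Nw].
  - apply: sat_all => w Nw; apply: sat_imp; first exact: sat_lt.
    apply: sat_imp; first exact: sat_lt.
    apply: (@sat_imp _ _ _ _ _ _ False); first exact: sat_fcm.
    by [].
  - lra.
  rewrite int_lt_add1 ?cone_in // le_eqVlt => /orP[/eqP ->|]; last exact: IH.
  move=> x_gt0 cmx; apply: nleast; exists x => // w' Nw' w'_gt0 cmw'.
  by rewrite leNgt; apply/negP => /IH; apply.
apply: (below (w0 + 1) _ w0) => //; first exact/coneD/cone1.
by rewrite ltrDl.
Qed.

(** Units modulo [modulus d n] are closed under products, so [w] is built by multiplying in one
    modulus at a time. *)
Lemma coprime_multiple d n : N d -> N n ->
  (forall j, N j -> j < n ->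
     exists2 s, N s & exists2 q, N q & modulus d j * s = 1 + modulus d n * q) ->
  exists2 w, N w & 0 < w /\ (common_multiple d n w /\
    exists2 s, N s & exists2 q, N q & w * s = 1 + modulus d n * q).
Proof.
move=> Nd Nn mod_inv.
(* The guard is there because induction runs over the whole cone, while invertibility is assumed
   only below [n]. *)
pose P j := j < n + 1 -> exists2 w, N w & 0 < w /\ (common_multiple d j w /\
    exists2 s, N s & exists2 q, N q & w * s = 1 + modulus d n * q).
suff : P n by apply; rewrite ltrDl.
pose phi := ArImp (ArLt (ArVar 2) (tS (ArVar 1))) (arEx 3 (arAnd
  (ArLt ArZero (ArVar 3)) (arAnd (fcm 0 2 3) (arEx 4 (arEx 5 (ArEq
  (ArMul (ArVar 3) (ArVar 4)) (ArAdd ArOne (ArMul (tmod 0 1) (ArVar 5))))))))).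
pose e i := if i is 0%N then to_cone Nd else to_cone Nn.
apply: (@cone_ind 2 phi e) (Nn) => [j Nj|_|j Nj IH].
- apply: sat_imp; first exact: sat_lt.
  apply: sat_ex => w Nw; apply: sat_and; first exact: sat_lt.
  apply: sat_and; first exact: sat_fcm.
  by apply: sat_ex => s Ns; apply: sat_ex => q Nq; apply: sat_eq.
- exists 1; first exact: cone1.
  split; first exact: ltr01.
  split=> [j /cone_ge0|]; first lra.
  by exists 1; [exact: cone1|exists 0; [exact: cone0|ring]].
move=> lt_jn; have {}lt_jn : j < n by move: lt_jn; rewrite ltrD2r.
have [|w Nw [w_gt0 [cmw [s Ns [q Nq ws]]]]] := IH; first lra.
have [s' Ns' [q' Nq' ms]] := mod_inv j Nj lt_jn.
have Nm : N (modulus d j) by exact: cone_modulus.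
have Nm' : N (modulus d n) by exact: cone_modulus.
exists (w * modulus d j); first exact: coneM.
split; first by rewrite mulr_gt0 ?modulus_gt0.
split=> [i Ni|].
  rewrite int_lt_add1 ?cone_in // le_eqVlt => /orP[/eqP ->|lt_ij].
    by exists w => //; rewrite mulrC.
  have [c Nc ->] := cmw i Ni lt_ij; exists (c * modulus d j); first exact: coneM.
  by rewrite mulrA.
exists (s * s'); first exact: coneM.
exists (q + q' + modulus d n * q * q'); first by rewrite !(coneD, coneM, cone1).
by rewrite mulrACA ws ms; ring.
Qed.

(** Modulo [modulus d n], the element [modulus d j] is $-(n-j)d$. This divides $d^2$ because $n-j$
    divides $d$, and $d$ is a unit because $(n+1)d \equiv -1$. *)
Lemma modulus_inv d n j : N d -> N n -> N j -> 0 < d -> j < n ->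
  multiple_upto n d ->
  exists2 s, N s & exists2 q, N q & modulus d j * s = 1 + modulus d n * q.
Proof.
move=> Nd Nn Nj d_gt0 lt_jn mu.
have j0 := cone_ge0 Nj.
have lt1 : 1 <= n - j by apply: int_ge1; [rewrite rpredB ?cone_in|lra].
have [||e Ne dE] := mu (n - j - 1); [|lra|].
  by apply: cone_inP; [rewrite !rpredB ?rpred1 ?cone_in|lra].
rewrite subrK in dE.
have Nm := cone_modulus Nd Nj; have Nm' := cone_modulus Nd Nn.
have [m_gt0 m'_gt0] := (modulus_gt0 Nd Nj, modulus_gt0 Nd Nn).
(* The odd exponent gives $-((n+1)d)^3 \equiv 1$, which allows a non-negative inverse [s]. *)
pose s := e * (n + 1) ^+ 3 * d.
have Ns : N s by rewrite /s !exprS expr0 !(coneM, coneD, cone1).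
(* [modulus d j = u - (n - j) d] and [(n + 1) d = u - 1] with [u = modulus d n],
   so that [modulus d j * s = u s - (u - 1)^3]. *)
pose q := s - (modulus d n ^+ 2 - 3 * modulus d n + 3).
have E : modulus d j * s = 1 + modulus d n * q.
  have -> : modulus d j * s =
      modulus d n * s - ((n - j) * e) * (d ^+ 2 * (n + 1) ^+ 3).
    by rewrite /s /modulus; ring.
  by rewrite -dE /q /modulus; ring.
exists s => //; exists q => //; apply: cone_inP.
  by rewrite !(rpredB, rpredD, rpredM, rpredX, rpred_nat, rpred1) ?cone_in.
have e_gt0 : 0 < e by move: d_gt0; rewrite dE pmulr_rgt0 //; lra.
have n_gt0 : 0 < n + 1 by rewrite ltr_pwDr ?ltr01 ?cone_ge0.
have s_gt0 : 0 < s by rewrite !mulr_gt0 // exprn_gt0.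
rewrite -(pmulr_rge0 _ m'_gt0); have : 1 <= modulus d j * s.
  by apply: int_ge1; [rewrite rpredM ?cone_in|rewrite mulr_gt0].
by rewrite E; lra.
Qed.

Lemma euclid a b : a \in Z -> b \in Z -> 0 < b ->
  exists2 q, q \in Z & 0 <= a - q * b < b.
Proof.
move=> Za Zb b_gt0; have [q Zq /andP[lq gq]] := proj2 Zip (a / b).
exists q => //; rewrite subr_ge0 -ler_pdivlMr // lq /=.
by move: gq; rewrite ltr_pdivrMr // mulrDl mul1r => gq; rewrite ltrBlDr addrC.
Qed.

(** The remainder of [w'] by [w] is a common multiple smaller than [w], hence zero. *)
Lemma least_dvd d n w w' : N d -> N n -> N w -> 0 < w ->
  common_multiple d n w ->
  (forall x, N x -> 0 < x -> common_multiple d n x -> w <= x) ->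
  N w' -> common_multiple d n w' -> exists2 k, N k & w' = k * w.
Proof.
move=> Nd Nn Nw w_gt0 cmw minw Nw' cmw'.
have [k Zk /andP[r_ge0 r_lt]] := euclid (cone_in Nw') (cone_in Nw) w_gt0.
have Zr : w' - k * w \in Z by rewrite rpredB ?rpredM // cone_in.
have [r0|r0] := eqVneq (w' - k * w) 0.
  have w'E : w' = k * w by lra.
  exists k => //; apply: cone_inP => //.
  by rewrite -(pmulr_lge0 _ w_gt0) -w'E cone_ge0.
have : w <= w' - k * w.
  apply: minw => [||j Nj lt_jn]; [exact: cone_inP|by rewrite lt0r r0|].
  have [c Nc wE] := cmw j Nj lt_jn; have [c' Nc' w'E] := cmw' j Nj lt_jn.
  have E : w' - k * w = modulus d j * (c' - k * c) by rewrite wE w'E; ring.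
  exists (c' - k * c) => //; apply: cone_inP.
    by rewrite rpredB ?rpredM // cone_in.
  by rewrite -(pmulr_rge0 _ (modulus_gt0 Nd Nj)) -E.
lra.
Qed.

(** * Overspill *)

Lemma cone_lt_nat j (k : nat) : N j -> j < k%:R ->
  exists2 i : nat, (i < k)%N & j = i%:R.
Proof.
move=> Nj; elim: k => [|k IH]; first by have := cone_ge0 Nj; lra.
rewrite -natr1 int_lt_add1 ?cone_in ?cone_nat // le_eqVlt.
by case/orP=> [/eqP ->|/IH[i /ltnW ik ->]]; [exists k|exists i].
Qed.

(** Every standard [n] fits. If no infinite one did, fitting would pass from each [n] to [n + 1],
    and by induction the infinite [m] itself would fit. *)
Lemma fits_infinite m : N m -> (forall n : nat, n%:R < m) ->
  exists n, [/\ N n, fits m n & forall k : nat, k%:R < n].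
Proof.
move=> Nm m_inf.
have fits_nat (n : nat) : fits m n%:R.
  (* The product of the moduli is standard, hence below the infinite [m]. *)
  pose D := n`!; pose W := (\prod_(i < n) (1 + i.+1 * D))%N.
  exists D%:R; first exact: cone_nat.
  exists W%:R; first exact: cone_nat.
  rewrite !ltr0n fact_gt0 prodn_gt0 //; do 2!split=> //.
  split; first by have := m_inf W; lra.
  split=> j Nj /(cone_lt_nat Nj)[i lt_in ->].
    have /dvdnP[q Dq] : (i.+1 %| D)%N by apply: dvdn_fact.
    by exists q%:R; [exact: cone_nat|rewrite Dq natrM mulrC natr1].
  have /dvdnP[q Wq] : (1 + i.+1 * D %| W)%N.
    by rewrite /W (bigD1 (Ordinal lt_in)) //= dvdn_mulr.
  exists q%:R; first exact: cone_nat.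
  by rewrite Wq natrM mulrC /modulus natrD natrM natr1.
apply: contrapT => nfit.
have all_fit : forall n, N n -> fits m n.
  apply: fits_ind => // [|n Nn fn]; first exact: (fits_nat 0%N).
  have /existsNP[k /negP] : ~ forall k : nat, k%:R < n.
    by move=> n_inf; apply: nfit; exists n.
  rewrite -leNgt => le_nk.
  have [||i _ ->] := @cone_lt_nat (n + 1) k.+2; last exact: fits_nat.
    exact: coneD cone1.
  by rewrite -!natr1; lra.
by apply: nfit; exists m; split=> //; apply: all_fit.
Qed.

(** * Fast growth of the least common multiples *)

Lemma least_multiple_growth d x y e e' : N d -> N x -> N y -> 0 < d ->
  multiple_upto x d -> x < y ->
  [/\ N e, 0 < e, common_multiple d x e &
    forall w, N w -> 0 < w -> common_multiple d x w -> e <= w] ->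
  [/\ N e', 0 < e' & common_multiple d y e'] -> d * e < e'.
Proof.
move=> Nd Nx Ny d_gt0 mu lt_xy [Ne e_gt0 cme mine] [Ne' e'_gt0 cme'].
have [|w Nw [w_gt0 [cmw [s Ns [q Nq ws]]]]] := coprime_multiple Nd Nx.
  by move=> j Nj lt_jx; apply: modulus_inv.
have [|k Nk e'E] := least_dvd Nd Nx Ne e_gt0 cme mine Ne'.
  by move=> j Nj lt_jx; apply: cme' => //; apply: lt_trans lt_xy.
have [k2 Nk2 wE] := least_dvd Nd Nx Ne e_gt0 cme mine Nw cmw.
have [q' Nq' e'E'] := cme' x Nx lt_xy.
have k_gt0 : 0 < k by move: e'_gt0; rewrite e'E pmulr_lgt0.
have u_gt0 := modulus_gt0 Nd Nx.
(* With $u$ = [modulus d x], multiplying $ws - uq = 1$ by $k$ and using $kw = k_2e' = k_2uq'$ shows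
   that $u$ divides $k$; and $u > d$. *)
pose t := q' * k2 * s - k * q.
have kE : k = modulus d x * t.
  have -> : modulus d x * t = (modulus d x * q') * k2 * s - k * (modulus d x * q).
    by rewrite /t; ring.
  have -> : modulus d x * q = w * s - 1 by rewrite ws; ring.
  by rewrite -e'E' e'E wE; ring.
have t_ge1 : 1 <= t.
  apply: int_ge1; first by rewrite !(rpredB, rpredM) // cone_in.
  by move: k_gt0; rewrite kE pmulr_rgt0.
rewrite e'E ltr_pM2r // kE; apply: (@lt_le_trans _ _ (modulus d x)).
  rewrite /modulus mulrDl mul1r; have := mulr_ge0 (cone_ge0 Nx) (cone_ge0 Nd).
  lra.
by rewrite ler_peMr // ltW.
Qed.

Lemma fast_sequence m : N m -> (forall n : nat, n%:R < m) ->
  exists B, [/\ N B, forall n : nat, n%:R < B & exists E : K -> K,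
    (forall x, N x -> x <= B -> 1 <= E x <= m) /\
    (forall x y, N x -> N y -> x < y -> y <= B ->
       forall n : nat, n%:R * E x < E y)].
Proof.
move=> Nm m_inf; have [B [NB [d Nd [w0 Nw0 fB]] B_inf]] := fits_infinite Nm m_inf.
have [d_gt0 [w0_gt0 [w0_lt [mu cm0]]]] := fB.
(* Each standard $n+1$ divides [d], so growth by the factor [d] exceeds growth by any standard
   factor. *)
have d_inf (n : nat) : n%:R < d.
  have [q Nq dE] := mu n%:R (cone_nat n) (B_inf n).
  have q_ge1 : 1 <= q.
    by apply: int_ge1; [exact: cone_in|move: d_gt0; rewrite dE pmulr_rgt0 // natr1].
  have n1_gt0 : 0 < n%:R + 1 :> K by rewrite natr1.
  by rewrite dE (@lt_le_trans _ _ (n%:R + 1)) ?ltrDl // ler_peMr // ltW.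
have le_upto x z : x <= B -> common_multiple d B z -> common_multiple d x z.
  by move=> le_xB cm j Nj lt_jx; apply: cm => //; apply: lt_le_trans le_xB.

pose least x e := [/\ N e, 0 < e, common_multiple d x e &
  forall w, N w -> 0 < w -> common_multiple d x w -> e <= w].
pose E x := xget 0 [set e | least x e].
(* The default 0 in [E] is not reached here, since [w0] is a common multiple. *)
have leastE x : N x -> x <= B -> least x (E x).
  move=> Nx le_xB; have cmx := le_upto _ _ le_xB cm0.
  have [e [Ne [e_gt0 cme]] mine] := least_multiple Nd Nx Nw0 w0_gt0 cmx.
  exact: (@xgetPex _ 0 [set e | least x e] (ex_intro _ e (And4 Ne e_gt0 cme mine))).
exists B; split=> //; exists E; split=> [x Nx le_xB|x y Nx Ny lt_xy le_yB n].
  have [Ne e_gt0 cme mine] := leastE x Nx le_xB.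
  rewrite int_ge1 ?cone_in //=; apply: (@le_trans _ _ w0).
    by apply: mine => //; apply: le_upto cm0.
  by rewrite -int_lt_add1 ?cone_in.
have le_xB := ltW (lt_le_trans lt_xy le_yB).
have le1 := leastE x Nx le_xB; have [Ne' e'_gt0 cme' _] := leastE y Ny le_yB.
apply: le_lt_trans (least_multiple_growth Nd Nx Ny d_gt0 _ lt_xy le1 _) => //.
  by have [_ e_gt0 _ _] := le1; rewrite ler_pM2r // ltW.
by move=> j Nj lt_jx; apply: mu => //; apply: lt_le_trans le_xB.
Qed.

(** The sequence is precomposed with the floor; points at distance at least 1 have different
    floors. *)
Lemma fast_function T : (forall n : nat, n%:R < T) ->
  exists B (F : K -> K), [/\ forall n : nat, n%:R < B,
    forall y, 1 <= y <= B -> F y <= T,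
    forall y, 1 <= y <= B -> forall n : nat, n%:R < F y &
    forall y y', 1 <= y -> y + 1 <= y' <= B ->
      forall n : nat, n%:R * F y < F y'].
Proof.
move=> T_inf; have [m Zm /andP[le_mT lt_Tm]] := proj2 Zip T.
have m_inf (n : nat) : n%:R < m by have := T_inf n.+1; rewrite -natr1; lra.
have Nm : N m by apply: cone_inP => //; apply/ltW/(m_inf 0%N).
have [B [NB B_inf [E [E_bd E_gr]]]] := fast_sequence Nm m_inf.
have N0 := cone0; have B_ge0 := cone_ge0 NB.
pose fl (y : K) := xget 0 [set z | z \in Z /\ z <= y < z + 1].
have flP y : fl y \in Z /\ fl y <= y < fl y + 1.
  have [z Zz zP] := proj2 Zip y.
  exact: (@xgetPex _ 0 [set z | z \in Z /\ z <= y < z + 1] (ex_intro _ z (conj Zz zP))).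
have flN y : 1 <= y <= B -> [/\ N (fl y), 0 < fl y & fl y <= B].
  have [Zf /andP[le_f lt_f]] := flP y => /andP[y1 yB].
  have f_gt0 : 0 < fl y by lra.
  by split=> //; [apply: cone_inP => //; exact: ltW|lra].
exists B, (fun y => E (fl y)); split=> //.
- move=> y /flN[Nf _ fB]; have /andP[_] := E_bd _ Nf fB; lra.
(* As the floor of [y] is positive, comparison with $E(0) \ge 1$ makes [E (fl y)] infinite. *)
- move=> y /flN[Nf f_gt0 fB] n; apply: le_lt_trans (E_gr _ _ N0 Nf f_gt0 fB n).
  by rewrite ler_peMr //; have /andP[] := E_bd _ N0 B_ge0.
- move=> y y' y1 /andP[yy' y'B].
  have [|Nf f_gt0 fB] := flN y; first lra.
  have [|Nf' f'_gt0 f'B] := flN y'; first lra.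
  have [_ /andP[le_f _]] := flP y; have [_ /andP[_ lt_f]] := flP y'.
  by apply: E_gr => //; lra.
Qed.

End FastSequence.

(** * The natural valuation *)

Section HahnValuation.
Context {R : realType} {G : oagType}.
Local Notation K := (hahnSeries R G).
Implicit Types (f h : K) (g : G).

Definition hval f : G := xget 0 [set m | f m != 0 /\ vanish_below f m].

Lemma hval_lead f : f != 0 -> f (hval f) != 0 /\ vanish_below f (hval f).
Proof.
move=> /hsupp_min[m fm vm].
exact: (@xgetPex _ 0 [set m | f m != 0 /\ vanish_below f m] (ex_intro _ m (conj fm vm))).
Qed.

Lemma hval_eq f g : f g != 0 -> vanish_below f g -> hval f = g.
Proof.
move=> fg vg; have f0 : f != 0 by apply: contraNneq fg => ->; rewrite hcoef0.
have [fv vv] := hval_lead f0; apply/eqP; rewrite eq_le !leNgt.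
apply/andP; split; apply/negP => lt; first by rewrite vv ?eqxx in fg.
by rewrite vg ?eqxx in fv.
Qed.

Lemma hval_mono c g : c != 0 -> hval (hmono c g : K) = g.
Proof.
move=> c0; apply: hval_eq; rewrite ?hcoef_mono ?eqxx // => x lt_xg.
by rewrite hcoef_mono lt_eqF.
Qed.

Lemma hval1 : hval (1 : K) = 0.
Proof. by apply: hval_mono; rewrite oner_eq0. Qed.

Lemma lead_gt0 f : 0 < f -> 0 < f (hval f).
Proof. by case/hahn_gt0P => m fm vm; rewrite (@hval_eq _ m) // gt_eqF. Qed.

Lemma hcoefMn f n g : (f *+ n) g = f g *+ n.
Proof. by elim: n => [|n IH]; rewrite ?mulr0n // !mulrS hcoefD IH. Qed.

Lemma ge0_coef f : (forall g, 0 <= f g) -> 0 <= f.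
Proof.
move=> f_ge0; have [->//|f0] := eqVneq f 0; have [fv vv] := hval_lead f0.
by apply/ltW/hahn_gt0P; exists (hval f) => //; rewrite lt0r fv f_ge0.
Qed.

Lemma vanish_hval f : 0 < f -> vanish_below f (hval f).
Proof. by move=> /lt0r_neq0/hval_lead[]. Qed.

Lemma le_hval f h : 0 < f -> f <= h -> hval h <= hval f.
Proof.
move=> f_gt0 le_fh; rewrite leNgt; apply/negP => lt_v.
have vf := vanish_hval f_gt0; have vh := vanish_hval (lt_le_trans f_gt0 le_fh).
suff : 0 < f - h by rewrite subr_gt0 ltNge le_fh.
apply/hahn_gt0P; exists (hval f) => [|x lt_x]; rewrite hcoefB.
  by rewrite (vh _ lt_v) subr0 lead_gt0.
by rewrite vf // vh ?subr0 // (lt_trans lt_x).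
Qed.

(** The reals are Archimedean: if $v(f) \le v(h)$, a natural number $n$ above the ratio of the
    coefficients of $h$ and $f$ at their leading exponents gives $nf > h$. *)
Lemma lt_hval f h : 0 < f -> (forall n : nat, n%:R * f < h) -> hval h < hval f.
Proof.
move=> f_gt0 f_lt; rewrite ltNge; apply/negP => le_v.
have h_gt0 : 0 < h by rewrite (le_lt_trans _ (f_lt 0%N)) ?mul0r.
have [vf vh] := (vanish_hval f_gt0, vanish_hval h_gt0).
have c_gt0 := lead_gt0 f_gt0.
have n_gt := archi_boundP (ltW (divr_gt0 (lead_gt0 h_gt0) c_gt0)).
set n := Num.bound _ in n_gt; rewrite ltr_pdivrMr // in n_gt.
suff : 0 < n%:R * f - h by rewrite subr_gt0 ltNge ltW.
apply/hahn_gt0P; exists (hval f) => [|x lt_x].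
  rewrite hcoefB mulr_natl hcoefMn subr_gt0 -mulr_natl (le_lt_trans _ n_gt) //.
  by move: le_v; rewrite le_eqVlt => /orP[/eqP->//|/vh ->]; apply/ltW/lead_gt0.
by rewrite hcoefB mulr_natl hcoefMn vf // vh ?mul0rn ?subrr // (lt_le_trans lt_x).
Qed.

Lemma natr_lt_hval f (n : nat) : 0 < f -> hval f < 0 -> n%:R < f.
Proof.
move=> f_gt0 v_lt0; rewrite -subr_gt0; apply/hahn_gt0P.
exists (hval f) => [|x lt_x].
  by rewrite hcoefB hcoefMn hcoef1 lt_eqF // mul0rn subr0 lead_gt0.
rewrite hcoefB hcoefMn hcoef1 lt_eqF ?(lt_trans lt_x) // mul0rn subr0.
exact: vanish_hval lt_x.
Qed.

Lemma hval_lt0 f : (forall n : nat, n%:R < f) -> hval f < 0.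
Proof.
move=> f_inf; rewrite -hval1; apply: lt_hval; first exact: ltr01.
by move=> n; rewrite mulr1.
Qed.

(** * Ladders: what the tower argument retains of arithmetic *)

Definition ladder (g : G) (B : K) (phi : K -> G) :=
  [/\ 0 < B, hval B < 0,
    forall y, 1 <= y <= B -> g <= phi y < 0 &
    forall y y', 1 <= y -> y + 1 <= y' <= B -> phi y' < phi y].

(** Take the valuation of a fast function bounded by $t^g$: the bound gives $g \le \phi$, infinite
    values give $\phi < 0$, and fast growth gives the strict decrease. *)
Lemma exists_ladder g : has_PA_integer_part K -> g < 0 ->
  exists B phi, ladder g B phi.
Proof.
move=> [Z [Zip [_ Zind]]] g_lt0.
pose T : K := hmono 1 g.
have vT : hval T = g by apply: hval_mono; rewrite oner_eq0.
have T_gt0 : 0 < T.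
  apply/hahn_gt0P; exists g => [|x lt_x]; rewrite hcoef_mono ?eqxx ?ltr01 //.
  by rewrite lt_eqF.
have T_inf n : n%:R < T by apply: natr_lt_hval; rewrite ?vT.
have [B [F [B_inf F_le F_inf F_gr]]] := fast_function Zip Zind T_inf.
have F_gt0 y : 1 <= y <= B -> 0 < F y by move=> /F_inf/(_ 0%N).
exists B, (hval \o F); split=> [|||y y' y1 yy'] /=.
- exact: B_inf 0%N.
- exact: hval_lt0.
- move=> y yB; rewrite -{1}vT le_hval ?F_gt0 ?F_le //=.
  exact/hval_lt0/F_inf.
- apply: lt_hval; last exact: F_gr.
  apply: F_gt0; rewrite y1; case/andP: yy' => yy'.
  by apply/le_trans/(le_trans _ yy'); rewrite lerDl.
Qed.

(** * Indicator series of well-ordered sets *)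

Definition ind_coef (A : set G) (g : G) : R :=
  if `[< A g /\ well_ordered_set A >] then 1 else 0.

Fact ind_subproof A : well_ordered_set [set g | ind_coef A g != 0].
Proof.
have [woA|nwoA] := pselect (well_ordered_set A).
  by apply: wo_sub woA => g; rewrite /= /ind_coef; case: asboolP => [[]|]; rewrite ?eqxx.
apply: wo_sub wo_set0 => g; rewrite /= /ind_coef.
by case: asboolP => [[_ /nwoA]|]; rewrite ?eqxx.
Qed.

(* The sum of all t ^ g with g in A; the junk value is 0 if A is not well-ordered. *)
Definition ind (A : set G) : K := HahnSeries (@ind_subproof A).

Lemma indT A g : well_ordered_set A -> A g -> ind A g = 1.
Proof. by move=> woA Ag; rewrite /= /ind_coef asboolT. Qed.

Lemma indF A g : ~ A g -> ind A g = 0.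
Proof. by move=> nAg; rewrite /= /ind_coef asboolF // => -[]. Qed.

Lemma ind_ge0 A : 0 <= ind A.
Proof. by apply: ge0_coef => g; rewrite /= /ind_coef; case: ifP; rewrite ?ler01. Qed.

(** The difference of the two series has the least new element as leading exponent; this is
    negative, so subtracting 1 does not change the sign. *)
Lemma ind_ltS A A' : well_ordered_set A' -> A `<=` A' ->
  A' `\` A !=set0 -> (forall g, A' g -> g < 0) -> ind A + 1 <= ind A'.
Proof.
move=> woA' sAA' nA A'_lt0; have woA := wo_sub sAA' woA'.
have [m [A'm nAm] minm] := woA' _ (@subDsetl _ A' A) nA.
rewrite -subr_ge0; apply/ltW/hahn_gt0P; exists m => [|x lt_xm].
  by rewrite hcoefB hcoefD indT // indF // hcoef1 lt_eqF ?A'_lt0 // addr0 subr0 ltr01.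
have x_lt0 : x < 0 by apply: lt_trans lt_xm (A'_lt0 _ A'm).
rewrite hcoefB hcoefD hcoef1 (lt_eqF x_lt0) addr0.
have [A'x|nA'x] := pselect (A' x); last by rewrite !indF ?subrr // => /sAA'.
have [Ax|nAx] := pselect (A x); first by rewrite !indT ?subrr.
by have := minm x (conj A'x nAx); rewrite leNgt lt_xm.
Qed.

Lemma ind_lt_inf A f : 0 < f -> hval f < 0 -> (forall g, A g -> hval f < g) ->
  1 <= f - ind A.
Proof.
move=> f_gt0 v_lt0 A_gt; rewrite -subr_ge0; apply/ltW/hahn_gt0P.
have nA x : x <= hval f -> ~ A x by move=> le_x /A_gt; rewrite ltNge le_x.
exists (hval f) => [|x lt_x].
  rewrite !hcoefB hcoef1 indF; last exact: nA.
  by rewrite lt_eqF // !subr0 lead_gt0.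
rewrite !hcoefB hcoef1 indF; last exact/nA/ltW.
rewrite lt_eqF ?(lt_trans lt_x) // !subr0.
exact: vanish_hval lt_x.
Qed.

End HahnValuation.

(** * Towers of well-ordered sets and Zorn's lemma *)

Section Tower.
Context {R : realType} {G : oagType}.
Local Notation K := (hahnSeries R G).
Variables (g : nat -> G) (B : nat -> K) (phi : nat -> K -> G).
Hypothesis ladd : forall n, ladder (g n) (B n) (phi n).
Hypothesis lt_Bg : forall n, hval (B n) < g n.+1.

Definition bounded n (A : set G) :=
  well_ordered_set A /\ forall x, A x -> g n <= x < 0.

Definition next n (A : set G) : G := phi n (B n - ind A).

Lemma ge1_Bind n A : bounded n.+1 A -> 1 <= B n - ind A.
Proof.
move=> [woA A_bd]; have [B_gt0 vB _ _] := ladd n; apply: ind_lt_inf => // x.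
by move=> /A_bd/andP[le_gx _]; apply: lt_le_trans le_gx.
Qed.

Lemma next_bounded n A : bounded n.+1 A -> g n <= next n A < 0.
Proof.
move=> bA; have [_ _ + _] := ladd n; apply.
by rewrite ge1_Bind // lerBlDr lerDl ind_ge0.
Qed.

(** Enlarging the set lowers [B n - ind A] by at least 1, and [phi n] reverses the order at that
    distance. *)
Lemma next_lt n A A' : bounded n.+1 A' -> A `<=` A' -> A' `\` A !=set0 ->
  next n A < next n A'.
Proof.
move=> bA' sAA' nA; have [_ _ _] := ladd n; apply; first exact: ge1_Bind.
have := @ind_ltS R G _ _ (proj1 bA') sAA' nA
  (fun x A'x => proj2 (andP (proj2 bA' x A'x))).
rewrite lerBlDr lerDl ind_ge0 andbT -addrA lerD2l [- _ + 1]addrC lerBlDr.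
by rewrite [_ + ind A']addrC lerBrDr addrC.
Qed.

Lemma next_le n A A' : bounded n.+1 A' -> A `<=` A' -> next n A <= next n A'.
Proof.
move=> bA' sAA'; have [nA|nA] := pselect (A' `\` A !=set0).
  by apply/ltW/next_lt.
suff -> : A = A' by [].
apply/seteqP; split=> // x A'x; apply: contrapT => nAx; apply: nA.
by exists x.
Qed.

Definition is_tower (S : nat -> set G) :=
  forall n, bounded n (S n) /\ forall x, S n x -> x < next n (S n.+1).

(** Inclusion would not do as the order for Zorn's lemma: unions of its chains may fail to be
    well-ordered. *)
Definition end_ext (S S' : nat -> set G) := forall n, S n `<=` S' n /\
  forall x y, S' n x -> S n y -> x <= y -> S n x.

Lemma end_ext_antisym S S' : end_ext S S' -> end_ext S' S -> S = S'.
Proof.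
move=> SS' S'S; apply/funext => n; apply/seteqP.
by split; [case: (SS' n)|case: (S'S n)].
Qed.

Lemma end_ext_trans S S' S'' : end_ext S S' -> end_ext S' S'' -> end_ext S S''.
Proof.
move=> SS' S'S'' n; have [s1 e1] := SS' n; have [s2 e2] := S'S'' n.
split=> [|x y S''x Sy le_xy]; first exact: subset_trans s2.
by apply: (e1 x y) => //; apply: (e2 x y) => //; apply: s1.
Qed.

(** A non-empty [D] meets a member of the chain, which is an initial segment of the union, so the
    least element found there is least in [D]. The strict bounds survive because [next] is
    monotone. *)
Lemma tower_union (C : set (nat -> set G)) : (forall S, C S -> is_tower S) ->
  (forall S S', C S -> C S' -> end_ext S S' \/ end_ext S' S) ->
  let U n := [set x | exists2 S, C S & S n x] in
  is_tower U /\ forall S, C S -> end_ext S U.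
Proof.
move=> Ct Ctot U.
have ext S : C S -> end_ext S U.
  move=> CS n; split=> [x Sx|x y [S' CS' S'x] Sy le_xy]; first by exists S.
  have [SS'|S'S] := Ctot S S' CS CS'; first by apply: (proj2 (SS' n)) Sy le_xy.
  exact: (proj1 (S'S n)).
have bU n : bounded n (U n).
  split=> [D DU [d Dd]|x [S CS Sx]]; last by have [[_ +] _] := Ct S CS n; apply.
  have [S CS Sd] := DU d Dd; have [[woS _] _] := Ct S CS n.
  have [||m [Dm Sm] minm] := woS (D `&` S n); first exact: subIsetr.
    by exists d.
  exists m => // x Dx; rewrite leNgt; apply/negP => lt_xm.
  suff Sx : S n x by have := minm x (conj Dx Sx); rewrite leNgt lt_xm.
  by apply: (proj2 (ext S CS n)) Sm (ltW lt_xm); apply: DU.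
split=> // n; split=> // x [S CS Sx]; have [_ /(_ x Sx) lt_x] := Ct S CS n.
exact/(lt_le_trans lt_x)/next_le/(proj1 (ext S CS n.+1)).
Qed.

Lemma tower_step S : is_tower S ->
  let S' n := S n `|` [set next n (S n.+1)] in is_tower S' /\ end_ext S S'.
Proof.
move=> tS S'.
have bS n : bounded n (S n) by have [] := tS n.
have ltS n x : S n x -> x < next n (S n.+1) by have [_] := tS n; apply.
have bS' n : bounded n (S' n).
  split=> [|x [|->]]; last exact: next_bounded.
    by apply: wo_setU (wo_set1 _); case: (bS n).
  by case: (bS n) => _; apply.
(* Level [n + 1] gains a new point, which pushes [next n] strictly above the point added at level
   [n]. *)
have lt_next n : next n (S n.+1) < next n (S' n.+1).
  apply: next_lt => //; first exact: subsetUl.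
  exists (next n.+1 (S n.+2)); split; first by right.
  by move=> /ltS; rewrite ltxx.
split=> n; split=> //.
- by move=> x [/ltS lt_x|->] //; apply: lt_trans lt_x _.
- exact: subsetUl.
- by move=> x y [//|->] /ltS lt_y; rewrite leNgt lt_y.
Qed.

Lemma no_ladder_sequence : False.
Proof.
pose T := {S | is_tower S}.
pose rel_ext (S S' : T) := `[< end_ext (sval S) (sval S') >].
have [|||C Ctot|[S tS] maxS] := @Zorn T rel_ext.
- by move=> S; apply/asboolP => n; split.
- by move=> S S' S'' /asboolP SS' /asboolP S'S''; apply/asboolP/(end_ext_trans SS').
- move=> [S tS] [S' tS'] /asboolP/= SS' /asboolP/= S'S.
  by apply: eq_exist; apply: end_ext_antisym.
(* The empty chain is included: its union is the empty tower. *)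
- have [|S S'|tU ext] := @tower_union (sval @` C).
  + by move=> _ [[S tS] _ <-].
  + move=> [s Cs <-] [s' Cs' <-].
    by case: (Ctot s s' Cs Cs') => /asboolP; [left|right].
  exists (exist _ _ tU) => s Cs; apply/asboolP; apply: ext.
  by exists s.
have [tS' ext] := tower_step tS.
(* By maximality [S 0] already contains its own strict upper bound. *)
have /(congr1 (fun s => sval s 0%N)) /= E := maxS (exist _ _ tS') (asboolT ext).
have : S 0%N (next 0 (S 1%N)) by rewrite -E; right.
by have [_ ltS] := tS 0%N; move=> /ltS; rewrite ltxx.
Qed.

End Tower.

(** * Choice of the sequence of ladders *)

Lemma divisible_half {G : oagType} (g : G) : divisible_group G -> g < 0 ->
  exists2 h : G, g < h & h < 0.
Proof.
move=> divG g_lt0; have [h hE] := divG g 2%N isT.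
have h_lt0 : h < 0.
  rewrite ltNge; apply/negP => h_ge0; move: g_lt0; rewrite -hE mulr2n ltNge.
  by rewrite (le_trans h_ge0) // -[X in X <= _]addr0 oag_leD2l.
by exists h => //; rewrite -hE mulr2n -[X in _ < X]addr0 oag_ltD2l.
Qed.

Theorem corollary14 (R : realType) (G : oagType)
    (Gdiv : divisible_group G) (Gnontriv : exists g : G, g != 0) :
  ~ IPA_real_closed_field (hahnSeries R G) /\
  ~ has_PA_integer_part (hahnSeries R G).
Proof.
suff noPA : ~ has_PA_integer_part (hahnSeries R G) by split=> // -[].
move=> hasPA.
have /choice[half halfP] : forall g : G, exists h, g < 0 -> g < h /\ h < 0.
  move=> g; have [g_lt0|ge] := pselect (g < 0); last by exists 0 => /ge.
  by have [h gh h0] := divisible_half Gdiv g_lt0; exists h.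
have /choice[lad ladP] : forall g : G, exists p : hahnSeries R G * (hahnSeries R G -> G),
    g < 0 -> ladder g p.1 p.2.
  move=> g; have [g_lt0|ge] := pselect (g < 0); last by exists (0, fun=> 0) => /ge.
  by have [B [phi Bphi]] := exists_ladder hasPA g_lt0; exists (B, phi).
have [g0 g0_lt0] : exists g : G, g < 0.
  have [g g_neq0] := Gnontriv; have [lt|gt|E] := ltgtP g 0; first by exists g.
    exists (- g); rewrite -(oag_ltD2r g) addNr add0r //.
  by rewrite E eqxx in g_neq0.
(* Halving $v(B_n)$, possible by divisibility, gives $v(B_n) < g_{n+1} < 0$. *)
pose g n := iter n (fun x => half (hval (lad x).1)) g0.
have g_lt0 n : g n < 0.
  elim: n => [//|n /ladP[_ v_lt0 _ _]]; exact: (proj2 (halfP _ v_lt0)).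
apply: (@no_ladder_sequence R G g (fun n => (lad (g n)).1) (fun n => (lad (g n)).2)) => n.
  exact: ladP.
by have [_ v_lt0 _ _] := ladP _ (g_lt0 n); case: (halfP _ v_lt0).
Qed.
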